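(* Let $\Sigma$ be a finite nonempty alphabet, let $m, n$ be integers with $0 < m < n < 2m$, and let $S \subseteq \Sigma^m \cup \Sigma^n$ be such that $S^*$ is co-finite. Then $S^* \ne \Sigma^*$, and every word in $\Sigma^* \setminus S^*$ has length at most $g(m,l) = ml - m - l$, where $l = m|\Sigma|^{n-m} + n - m$.
   Context: $\Sigma^j$ denotes the set of words of length exactly $j$ over $\Sigma$. A language $L \subseteq \Sigma^*$ is co-finite if $\Sigma^* \setminus L$ is finite. *)

(* Defs.v *)
From mathcomp Require Import all_boot all_order all_algebra.
From mathcomp Require Import classical_sets cardinality.

Set Implicit Arguments.
Unset Strict Implicit.
Unset Printing Implicit Defensive.

Local Open Scope classical_set_scope.

Definition language (Sigma : finType) := set (seq Sigma).

Definition words (Sigma : finType) (j : nat) : language Sigma :=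
  [set w | size w = j].

Definition star (Sigma : finType) (L : language Sigma) : language Sigma :=
  [set w | exists2 us : seq (seq Sigma),
             (forall u, u \in us -> L u) & w = flatten us].

Definition cofinite (Sigma : finType) (L : language Sigma) : Prop :=
  finite_set (~` L).

(* Valued in int, so that the subtractions are not truncated. *)
Definition g (a b : nat) : int := (a%:Z * b%:Z - a%:Z - b%:Z)%R.

(* Main.v *)
Require Import Defs.
From mathcomp Require Import all_boot all_order all_algebra.
From mathcomp Require Import classical_sets cardinality.
From mathcomp Require Import boolp zify.

Set Implicit Arguments.
Unset Strict Implicit.
Unset Printing Implicit Defensive.

Local Open Scope classical_set_scope.

(** Write [d = n - m] and [q = #|Sigma| ^ d], so that [l = m q + d].
    - [S] contains every word [u] of length [m]: otherwise, for any [z] of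
      length [d] and any letter [x], the words [(u z)^k x] can only be parsed
      by reading [u z] over and over, which leaves [x], and [1 < m].
    - Every word [w] of length [l] has a factor of length [n] that starts at a
      multiple of [m] and lies in [S]: among the [q + 1] factors of length [d]
      of [w] starting at multiples of [m], two are the same word [z]. Let [x] be
      the part of [w] from the first occurrence of [z] up to the second. The
      aligned factors of length [n] of [x^k z] already occur in [x z], hence in
      [w]; if [S] missed them all, then [x^k z], whose length is [d] modulo [m],
      would have no parsing.
    Hence the star of [S] contains all words of lengths [m] and [l], and these
    lengths are coprime, so it contains all words longer than their Frobenius
    number. *)

Lemma coprime_lincomb a b N : coprime a b -> a.-1 * b.-1 <= N ->
  exists i j, N = i * a + j * b.
Proof.
have [-> /eqP|a_gt0 co_ab le_N] := posnP a.
  by rewrite gcd0n => -> _; exists 0, N; rewrite muln1.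
have /dvdnP[k Ek] : b %| chinese a b N 0.
  by rewrite /dvdn chinese_modr // mod0n.
set j := k %% a.
have Ej : j * b = N %[mod a] by rewrite modnMml -Ek chinese_modl.
have [le_jN|lt_Nj] := leqP (j * b) N.
  have /dvdnP[i Ei] : a %| N - j * b by rewrite -eqn_mod_dvd // Ej.
  by exists i, j; rewrite -Ei subnK.
have le_jb : j * b <= a.-1 * b.
  by rewrite leq_mul2r -ltnS prednK // ltn_mod a_gt0 orbT.
have /dvdn_leq : a %| j * b - N by rewrite -eqn_mod_dvd ?Ej // ltnW.
by rewrite -[b.-1]subn1 mulnBr muln1 in le_N; lia.
Qed.

Section Star.

Variable Sigma : finType.
Implicit Types (L : language Sigma) (u v w : seq Sigma).

Lemma star_nil L : star L [::].
Proof. by exists [::]. Qed.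

Lemma star_cons L u v : L u -> star L v -> star L (u ++ v).
Proof.
move=> Lu [us Lus ->]; exists (u :: us) => // x.
by rewrite in_cons => /predU1P[->|/Lus].
Qed.

Lemma star_ind L (P : set (seq Sigma)) :
    P [::] -> (forall u v, L u -> star L v -> P v -> P (u ++ v)) ->
  star L `<=` P.
Proof.
move=> P0 Pcat w [us + ->]; elim: us => //= u us IHus Lus.
have L_tail v : v \in us -> L v.
  by move=> v_us; apply: Lus; rewrite in_cons v_us orbT.
by apply: Pcat; [apply/Lus/mem_head | exists us | exact: IHus].
Qed.

Lemma star_inv L w : star L w ->
  w = [::] \/ exists u v, [/\ L u, star L v & w = u ++ v].
Proof.
by move: w; apply: star_ind => [|u v Lu Lv _]; [left | right; exists u, v].
Qed.

Lemma sub_star L : L `<=` star L.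
Proof.
by move=> u Lu; rewrite -[u]cats0; apply: star_cons => //; exact: star_nil.
Qed.

Lemma star_cat L u v : star L u -> star L v -> star L (u ++ v).
Proof.
move=> Lu Lv; move: u Lu; apply: star_ind => // x u Lx _ Luv.
by rewrite -catA; exact: star_cons.
Qed.

Lemma star_words_dvdn L a w : words a `<=` star L -> a %| size w -> star L w.
Proof.
move=> La /dvdnP[k]; elim: k w => [|k IHk] w sz_w.
  by rewrite (size0nil sz_w); exact: star_nil.
rewrite -(cat_take_drop a w); apply: star_cat.
  by apply: La; rewrite /words /= size_takel // sz_w mulSn leq_addr.
by apply: IHk; rewrite size_drop sz_w mulSn addKn.
Qed.

Lemma star_words_lincomb L a b i j :
    words a `<=` star L -> words b `<=` star L ->
  words (i * a + j * b) `<=` star L.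
Proof.
move=> La Lb w sz_w; rewrite -(cat_take_drop (i * a) w).
apply: star_cat; [apply: (star_words_dvdn La) | apply: (star_words_dvdn Lb)].
  by rewrite size_takel ?dvdn_mull // sz_w leq_addr.
by rewrite size_drop sz_w addKn dvdn_mull.
Qed.

Lemma star_dvdn_size L e w :
  (forall u, L u -> e %| size u) -> star L w -> e %| size w.
Proof.
move=> Le; move: w; apply: star_ind => [|u v Lu _ dv_v]; first exact: dvdn0.
by rewrite size_cat dvdn_add // Le.
Qed.

Lemma star_size_geq L a w : (forall u, L u -> a <= size u) ->
  star L w -> w = [::] \/ a <= size w.
Proof.
move=> La /star_inv[|[u [v [/La le_au _ ->]]]]; [by left | right].
by rewrite size_cat (leq_trans le_au) ?leq_addr.
Qed.

End Star.

Section Cofinite.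

Variables (Sigma : finType) (L : language Sigma).
Hypothesis cofL : cofinite L.

Lemma cofinite_long_words : exists N, forall w, N < size w -> L w.
Proof.
have /finite_seqP[s Ls] := cofL; exists (\max_(u <- s) size u) => w lt_w.
apply: contrapT => nLw; have : w \in s by have : (~` L) w by []; rewrite Ls.
by move=> ws; have := @leq_bigmax_seq _ _ _ size _ ws isT; rewrite leqNgt lt_w.
Qed.

Lemma cofinite_dvdn_size (x : Sigma) e :
  (forall w, L w -> e %| size w) -> e = 1.
Proof.
move=> Le; have [N long] := cofinite_long_words.
have dv k : N < k -> e %| k.
  by move=> lt_Nk; rewrite -(size_nseq k x); apply/Le/long; rewrite size_nseq.
by apply/eqP; rewrite -dvdn1 -(dvdn_addr _ (dv N.+1 _)) // addn1 dv // ltnW.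
Qed.

End Cofinite.

Lemma size_iter_cat (T : Type) k (x z : seq T) :
  size (iter k (cat x) z) = k * size x + size z.
Proof. by elim: k => //= k IHk; rewrite size_cat IHk mulSn addnA. Qed.

Lemma prefix_iter_cat (T : eqType) k (x z : seq T) :
  prefix z (x ++ z) -> prefix z (iter k (cat x) z).
Proof.
move=> z_xz; elim: k => [|k IHk]; first exact: prefix_refl.
by apply: (prefix_trans z_xz); rewrite /= prefix_catr // eqxx.
Qed.

Lemma cofinite_iter_cat (Sigma : finType) (L : language Sigma) x z :
  cofinite L -> 0 < size x -> exists k, L (iter k.+1 (cat x) z).
Proof.
move=> /cofinite_long_words[N long] x_gt0; exists N; apply: long.
by rewrite size_iter_cat; nia.
Qed.

Lemma pigeonhole_words (Sigma : finType) d (f : nat -> seq Sigma) :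
    (forall i, i <= #|Sigma| ^ d -> size (f i) = d) ->
  exists i j, i < j <= #|Sigma| ^ d /\ f i = f j.
Proof.
move=> sz_f; set q := #|Sigma| ^ d in sz_f *.
pose F (i : 'I_q.+1) : d.-tuple Sigma :=
  Tuple (introT eqP (sz_f i (ltn_ord i))).
have /injectivePn[i [j neq_ij /(congr1 val) /= Eij]] : ~~ injectiveb F.
  by apply/negP=> /injectiveP/leq_card; rewrite card_tuple card_ord ltnn.
have [lt_ij|lt_ji|/val_inj E] := ltngtP i j.
- by exists i, j; rewrite lt_ij -ltnS ltn_ord.
- by exists j, i; rewrite lt_ji -ltnS ltn_ord.
- by rewrite E eqxx in neq_ij.
Qed.

Lemma repeated_aligned_factor (Sigma : finType) m d (w : seq Sigma) :
    0 < m -> m * #|Sigma| ^ d + d <= size w ->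
  exists a x z b, [/\ w = a ++ (x ++ z) ++ b, prefix z (x ++ z), size z = d,
    0 < size x & (m %| size a) && (m %| size x)].
Proof.
move=> m_gt0 le_w; pose factor i := take d (drop (i * m) w).
have room i : i <= #|Sigma| ^ d -> i * m + d <= size w by nia.
have sz_factor i : i <= #|Sigma| ^ d -> size (factor i) = d.
  by move=> /room ?; rewrite size_takel // size_drop; lia.
have [i [j [/andP[lt_ij /[dup] le_jq /room le_jw] Eij]]] :=
  pigeonhole_words sz_factor.
pose v := drop (i * m) w; pose e := (j - i) * m.
have Ev : drop (j * m) w = drop e v.
  by rewrite drop_drop -mulnDl subnK // ltnW.
have sz_v : e + d <= size v by rewrite size_drop /e; nia.
have Exz : take e v ++ factor j = take (e + d) v by rewrite takeD /factor Ev.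
exists (take (i * m) w), (take e v), (factor j), (drop (e + d) v).
rewrite Exz !cat_take_drop sz_factor // -Eij; split=> //.
- by rewrite prefixE sz_factor ?take_takel ?leq_addl //; lia.
- by rewrite size_takel /e ?muln_gt0 ?subn_gt0 ?lt_ij //; lia.
- by rewrite !size_takel ?dvdn_mull //=; [lia | nia].
Qed.

Section AlignedFactors.

Variables (T : eqType) (m n : nat).
Implicit Types (a b u v w x z : seq T).

Definition aligned_factors w : set (seq T) :=
  [set u | size u = n /\ exists a b, m %| size a /\ w = a ++ u ++ b].

Lemma aligned_factors_infix a x b : m %| size a ->
  aligned_factors x `<=` aligned_factors (a ++ x ++ b).
Proof.
move=> dv_a u [sz_u [a' [b' [dv_a' ->]]]]; split=> //.
by exists (a ++ a'), (b' ++ b); rewrite size_cat dvdn_add // -!catA.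
Qed.

Lemma aligned_factors_cat x v : m %| size x ->
  aligned_factors (x ++ v) `<=`
    aligned_factors (x ++ take (n - m) v) `|` aligned_factors v.
Proof.
move=> dv_x u [sz_u [a [b [dv_a Exv]]]].
have [lt_ax|le_xa] := ltnP (size a) (size x).
  left; split=> //; exists a, (take (size x + (n - m) - (size a + n)) b).
  have le_m_gap : m <= size x - size a by rewrite dvdn_leq ?subn_gt0 ?dvdn_sub.
  have -> : x ++ take (n - m) v = take (size x + (n - m)) (x ++ v).
    by rewrite takeD take_size_cat // drop_size_cat.
  split=> //; rewrite Exv catA take_cat size_cat sz_u.
  have -> : (size x + (n - m) < size a + n) = false by lia.
  by rewrite catA.
right; split=> //; exists (drop (size x) a), b; rewrite size_drop dvdn_sub //.
split=> //; move/eqP: Exv; rewrite -{1}(cat_take_drop (size x) a) -catA.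
by rewrite eqseq_cat ?size_takel // => /andP[_ /eqP].
Qed.

Lemma aligned_factors_iter_cat k x z :
    m %| size x -> size z = n - m -> prefix z (x ++ z) ->
  aligned_factors (iter k.+1 (cat x) z) `<=` aligned_factors (x ++ z).
Proof.
move=> dv_x sz_z z_xz; elim: k => // k IHk u.
rewrite iterS => /(aligned_factors_cat dv_x)[|/IHk//].
by have := prefix_iter_cat k.+1 z_xz; rewrite prefixE sz_z => /eqP ->.
Qed.

End AlignedFactors.

Lemma aligned_factors_pumping (Sigma : finType) m n (w : seq Sigma) :
    0 < m -> m * #|Sigma| ^ (n - m) + (n - m) <= size w ->
  exists x z, [/\ 0 < size x, m %| size x, size z = n - m &
    forall k, aligned_factors m n (iter k.+1 (cat x) z) `<=`
              aligned_factors m n w].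
Proof.
move=> m_gt0 /(repeated_aligned_factor m_gt0).
move=> [a [x [z [b [-> z_xz sz_z x_gt0 /andP[dv_a dv_x]]]]]].
exists x, z; split=> // k.
apply: subset_trans (aligned_factors_infix _ dv_a).
exact: aligned_factors_iter_cat.
Qed.

Section TwoLengths.

Variables (Sigma : finType) (m n : nat) (S : language Sigma).
Hypotheses (le_mn : m <= n) (subS : S `<=` words m `|` words n).
Implicit Types u v w x : seq Sigma.

Lemma star_two_lengths_short w : star S w -> size w < m -> w = [::].
Proof.
have geS u : S u -> m <= size u by case/subS=> ->.
by case/(star_size_geq geS) => // le_mw; rewrite ltnNge le_mw.
Qed.

Lemma star_cat_cancel x v :
  size x = n -> ~ S (take m x) -> star S (x ++ v) -> star S v.
Proof.
move=> sz_x nSx /star_inv[/eqP|[y [v' [Sy Sv' /eqP]]]].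
  by rewrite -size_eq0 size_cat addn_eq0 => /andP[_ /nilP ->]; exact: star_nil.
have [sz_y|sz_y] := subS Sy; last first.
  by rewrite eqseq_cat ?sz_x ?sz_y // => /andP[_ /eqP ->].
move/eqP/(congr1 (take m)); rewrite takel_cat ?sz_x // take_size_cat // => Exy.
by case: nSx; rewrite Exy.
Qed.

Lemma star_dvdn_or_aligned_factor w :
  star S w -> m %| size w \/ S `&` aligned_factors m n w !=set0.
Proof.
move: w; apply: star_ind => [|u v Su _ IHv]; first by left.
have [sz_u|sz_u] := subS Su; last first.
  by right; exists u; split=> //; split=> //; exists [::], v.
case: IHv => [dv_v|[y [Sy Fy]]]; first by left; rewrite size_cat sz_u dvdn_add.
right; exists y; split=> //; rewrite -[v]cats0; apply: aligned_factors_infix Fy.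
by rewrite sz_u.
Qed.

Hypothesis cofS : cofinite (star S).

Lemma coprime_of_cofinite_star (x : Sigma) : coprime m n.
Proof.
apply/eqP/(cofinite_dvdn_size cofS x) => w; apply: star_dvdn_size => u.
by case/subS=> ->; rewrite ?dvdn_gcdl ?dvdn_gcdr.
Qed.

Lemma words_sub_of_cofinite_star (x : Sigma) : 1 < m -> words m `<=` S.
Proof.
move=> m_gt1 u sz_u; apply: contrapT => nSu.
pose y := u ++ nseq (n - m) x.
have sz_y : size y = n by rewrite size_cat sz_u size_nseq subnKC.
have nSy : ~ S (take m y) by rewrite take_size_cat.
have unparsed k : ~ star S (iter k (cat y) [:: x]).
  elim: k => [/star_two_lengths_short/(_ m_gt1)//|k IHk].
  by move/(star_cat_cancel sz_y nSy).
have y_gt0 : 0 < size y by rewrite sz_y (leq_trans (ltnW m_gt1)).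
by have [k /unparsed] := cofinite_iter_cat [:: x] cofS y_gt0.
Qed.

Lemma aligned_factor_of_cofinite_star w : m < n < 2 * m ->
    m * #|Sigma| ^ (n - m) + (n - m) <= size w ->
  S `&` aligned_factors m n w !=set0.
Proof.
move=> /andP[lt_mn lt_n2m] /aligned_factors_pumping[|x [z]]; first by lia.
move=> [x_gt0 dv_x sz_z pump].
have [k /star_dvdn_or_aligned_factor] := cofinite_iter_cat z cofS x_gt0.
case=> [|[u [Su /pump Fu]]]; last by exists u.
by rewrite size_iter_cat sz_z dvdn_addr ?dvdn_mull // => /dvdn_leq; lia.
Qed.

Lemma star_words_of_cofinite_star : m < n < 2 * m -> words m `<=` star S ->
  words (m * #|Sigma| ^ (n - m) + (n - m)) `<=` star S.
Proof.
move=> lt_mn star_m w sz_w.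
have [u [Su [sz_u [a [b [dv_a Ew]]]]]] :=
  aligned_factor_of_cofinite_star lt_mn (eq_leq (esym sz_w)).
rewrite Ew; apply: star_cat; first exact: (star_words_dvdn star_m).
apply: star_cons => //; apply: (star_words_dvdn star_m).
have : m * #|Sigma| ^ (n - m) = size a + m + size b.
  by move: sz_w; rewrite Ew /words /= !size_cat sz_u; lia.
by move/(congr1 (dvdn m)); rewrite dvdn_mulr // dvdn_addr // dvdn_add.
Qed.

End TwoLengths.

Theorem theorem20 (Sigma : finType) (m n : nat) (S : language Sigma)
  (Sigma_nonempty : 0 < #|Sigma|)
  (m_gt0 : 0 < m) (lt_mn : m < n) (lt_n2m : n < 2 * m)
  (subS : S `<=` words m `|` words n)
  (cofS : cofinite (star S)) :
  let l := m * #|Sigma| ^ (n - m) + (n - m) in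
  star S <> setT /\
  (forall w : seq Sigma, (~` star S) w -> ((size w)%:Z <= g m l)%R).
Proof.
move=> l; have /card_gt0P[x _] := Sigma_nonempty.
have le_mn := ltnW lt_mn; have m_gt1 : 1 < m by lia.
split=> [star_all|w].
  have : star S [:: x] by rewrite star_all.
  by move/(star_two_lengths_short le_mn subS)/(_ m_gt1).
apply: contra_notP => /negP lt_gw.
have star_m : words m `<=` star S.
  apply: subset_trans (@sub_star _ S).
  exact: words_sub_of_cofinite_star le_mn subS cofS x m_gt1.
have star_l : words l `<=` star S.
  by apply: star_words_of_cofinite_star; rewrite ?lt_mn.
have co_ml : coprime m l.
  rewrite /l /coprime mulnC gcdnMDl -(gcdnMDl 1) mul1n subnKC //.
  exact: coprime_of_cofinite_star subS cofS x.
have le_w : m.-1 * l.-1 <= size w by rewrite /g in lt_gw; nia.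
have [i [j sz_w]] := coprime_lincomb co_ml le_w.
exact: star_words_lincomb star_m star_l _ sz_w.
Qed.
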